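(* Suppose Assumption (N) holds. Let $(f^n)_n$ in $Y$ and $f^\dagger\in Y$ be such that $\delta_i^n:=\|f_i^\dagger-f_i^n\|_{Y_i}\to0$ as $n\to\infty$ for all $i$. Let $I\subset\{1,\dots,N\}$, $I^c=\{1,\dots,N\}\setminus I$, and decompose $I=J_1\cup J_p$ with $J_1=\{i\in I: p_i=1\}$, $J_p=\{i\in I: p_i>1\}$. Let $\lambda^n\in(0,\infty)^N$ be such that $$\lambda_i^n\sim(\delta_i^n)^{-(p_i-\epsilon_i)}\ \text{ if }i\in J_1,\qquad\lambda_i^n\sim(\delta_i^n)^{-(p_i-1)}\ \text{ if }i\in J_p,$$ with $\epsilon_i\in(0,1)$, and $\lambda_i^n\to\lambda_i^\dagger\in(0,\infty)$ for $i\in I^c$; denote $\lambda^\dagger=\lim_n\lambda^n\in(0,\infty]^N$. For $i\in I^c$ let $\phi_i\colon[0,\infty)\to[0,\infty)$ be continuous, monotonically increasing with $\phi_i(0)=0$ and $|\lambda_i^\dagger-\lambda_i^n|\le\phi_i(\delta_i^n)$. Let $(u^n)_n$ be a sequence of solutions to $\min_{u\in\operatorname{dom}(T)}J_{\lambda^n}(u,f^n)$ and let $u^\dagger$ be a $J_{\lambda^\dagger,I^c}$-minimal solution to $T_Iu=f_I^\dagger$. Then there is $C>0$ such that for all but finitely many $n$ $$J_{\lambda^\dagger,I^c}(u^n,f^\dagger)\le J_{\lambda^\dagger,I^c}(u^\dagger,f^\dagger)+C\Big(\sum_{i\in J_1}(\delta_i^n)^{\epsilon_i}+\sum_{i\in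 J_p}\delta_i^n+\sum_{i\in I^c}(\delta_i^n+\phi_i(\delta_i^n))\Big).$$ Assume further that there exist $\xi\in\partial\big(J_{\lambda^\dagger,I^c}(\cdot,f^\dagger)\big)(u^\dagger)$ and constants $0<\beta_1<1$, $0<\beta_2$ such that $$-\langle\xi,u-u^\dagger\rangle\le\beta_1D^\xi_{J_{\lambda^\dagger,I^c}(\cdot,f^\dagger)}(u,u^\dagger)+\beta_2\sum_{i\in I}\|T_iu-T_iu^\dagger\|_{Y_i}$$ for all $u$ satisfying $J_{\lambda^\dagger,I^c}(u,f^\dagger)+\sum_{i\in I}\|T_iu-f_i^\dagger\|_{Y_i}^{p_i}\le J_{\lambda^\dagger}(u^\dagger,f^\dagger)+\epsilon$ for some $\epsilon>0$. Then, for $j\in I$, $$D^\xi_{J_{\lambda^\dagger,I^c}(\cdot,f^\dagger)}(u^n,u^\dagger)=O\Big(\sum_{i\in J_1}(\delta_i^n)^{\epsilon_i}+\sum_{i\in J_p}\delta_i^n+\sum_{i\in I^c}(\delta_i^n+\phi_i(\delta_i^n))\Big)$$ and, in case $p_j=1$, $$\|T_ju^n-f_j^n\|_{Y_j}=O\Big((\delta_j^n)^{1-\epsilon_j}\Big(\sum_{i\in J_1}(\delta_i^n)^{\epsilon_i}+\sum_{i\in J_p}\delta_i^n+\sum_{i\in I^c}(\delta_i^n+\phi_i(\delta_i^n))\Big)\Big),$$ and, in case $p_j>1$, $$\|T_ju^n-f_j^n\|_{Y_j}^{p_j}=O\Big((\delta_j^n)^{p_j-1}\Big(\sum_{i\in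 J_1}(\delta_i^n)^{\epsilon_i}+\sum_{i\in J_p}\delta_i^n+\sum_{i\in I^c}(\delta_i^n+\phi_i(\delta_i^n))\Big)\Big).$$
   Context: Setting. Let $(X,\|\cdot\|_X)$ be a Banach space and $R\colon X\to[0,\infty]$. For $i=1,\dots,N$ let $(Y_i,\|\cdot\|_{Y_i})$ be a normed space, $p_i\in[1,\infty)$ and $T_i\colon\operatorname{dom}(T_i)\subset X\to Y_i$ an operator. Put $\operatorname{dom}(T)=\bigcap_{i=1}^N\operatorname{dom}(T_i)$ and $Y=Y_1\times\cdots\times Y_N$; it is assumed that $\operatorname{dom}(T)$ contains a point where $R$ is finite. For $u\in\operatorname{dom}(T)$, $f\in Y$ and $\lambda\in(0,\infty]^N$ let $$J_\lambda(u,f)=R(u)+\sum_{i=1}^N\lambda_i\|T_iu-f_i\|_{Y_i}^{p_i},$$ where for $\lambda_i=\infty$ the $i$-th term is $0$ if $T_iu=f_i$ and $\infty$ otherwise. For $I\subset\{1,\dots,N\}$ put $J_{\lambda,I^c}(u,f)=R(u)+\sum_{i\in I^c}\lambda_i\|T_iu-f_i\|_{Y_i}^{p_i}$ for $u\in\operatorname{dom}(T)$ (and $+\infty$ for $u\in X\setminus\operatorname{dom}(T)$); $T_Iu=f_I^\dagger$ means $T_iu=f_i^\dagger$ for all $i\in I$. A $J_{\lambda^\dagger,I^c}$-minimal solution to $T_Iu=f_I^\dagger$ is a minimizer of $J_{\lambda^\dagger,I^c}(\cdot,f^\dagger)$ over $\{u\in\operatorname{dom}(T):T_Iu=f_I^\dagger\}$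 at which this functional is finite. For $F\colon X\to[0,\infty]$, $\xi\in\partial F(u)\subset X^*$ means $F(u)<\infty$ and $F(v)\ge F(u)+\langle\xi,v-u\rangle$ for all $v\in X$; the Bregman distance is $D_F^\xi(v,u)=F(v)-F(u)-\langle\xi,v-u\rangle$. For sequences, $x^n\sim y^n$ means there are $c,C>0$ with $cy^n\le x^n\le Cy^n$ for all $n$; $x^n=O(y^n)$ means there is $C>0$ with $x^n\le Cy^n$ for all sufficiently large $n$. Let $\tau_X$ be a Hausdorff topology on $X$ and $\tau_{Y_i}$ a Hausdorff topology on $Y_i$. Assumption (N): (1) Each $\|\cdot\|_{Y_i}$ is sequentially lower semi-continuous w.r.t. $\tau_{Y_i}$, and addition and scalar multiplication are continuous in the topology $\tau_{Y_i}$. (2) $R$ is lower semi-continuous w.r.t. $\tau_X$. (3) Each $T_i$ is continuous from $(X,\tau_X)$ (on $\operatorname{dom}(T_i)$) to $(Y_i,\tau_{Y_i})$ and $\operatorname{dom}(T_i)$ is closed w.r.t. convergence in $\tau_X$. (4) For any $\lambda\in(0,\infty)^N$, $f\in Y$ and any sequence $(u^n)_n$: if $J_\lambda(u^n,f)<c$ for all $n$ and some constant $c$, then $(u^n)_n$ admits a $\tau_X$-convergent subsequence. *)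

(* Defs.v *)
From HB Require Import structures.
From mathcomp Require Import all_boot all_order all_algebra.
From mathcomp Require Import all_classical all_reals all_analysis.

Set Implicit Arguments.
Unset Strict Implicit.
Unset Printing Implicit Defensive.

Import Order.TTheory GRing.Theory Num.Theory.
Import numFieldNormedType.Exports.

Local Open Scope classical_set_scope.
Local Open Scope ring_scope.

(* A topology on T given by its open sets. X and each Y_i carry such a topology
   besides their norm; [retop tau] is a copy of the carrier on which the library
   sees tau instead of the norm topology. *)
Record topology_on (T : Type) := TopologyOn {
  tau_open : set (set T);
  tau_openT : tau_open setT;
  tau_openI : forall A B, tau_open A -> tau_open B -> tau_open (A `&` B);
  tau_open_bigU : forall (I : Type) (f : I -> set T),
    (forall i, tau_open (f i)) -> tau_open (\bigcup_i f i)
}.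

Definition retop (T : choiceType) (tau : topology_on T) : Type := T.

HB.instance Definition _ (T : choiceType) (tau : topology_on T) :=
  Choice.copy (retop tau) T.
HB.instance Definition _ (T : choiceType) (tau : topology_on T) :=
  isOpenTopological.Build (retop tau)
    (@tau_openT T tau) (@tau_openI T tau) (@tau_open_bigU T tau).

Definition converges_in (T : choiceType) (tau : topology_on T)
    (u : nat -> T) (l : T) : Prop :=
  (u : nat -> retop tau) @ \oo --> (l : retop tau).

Section functionals.
Context (R : realType) (X : completeNormedModType R) (N : nat)
  (Y : 'I_N -> normedModType R).

(* The term lambda * ||y - f||^p, for 0 < lambda <= +oo. *)
Definition fidelity (V : normedModType R) (lam : \bar R) (p : R) (y f : V) :
    \bar R :=
  (if lam == +oo then (if y == f then 0 else +oo)
   else lam * (`|y - f| `^ p)%:E)%E.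

(* The operators are total functions; only their values on dom are ever used. *)
Context (reg : X -> \bar R) (p : 'I_N -> R)
  (dom : 'I_N -> set X) (T : forall i, X -> Y i).

Definition domT : set X := \bigcap_i dom i.

(* J_{lambda,A}; J_lambda is the case A = predT. *)
Definition Jfun (A : {pred 'I_N}) (lam : 'I_N -> \bar R) (f : forall i, Y i)
    (u : X) : \bar R :=
  (if u \in domT
   then reg u + \sum_(i in A) fidelity (lam i) (p i) (T i u) (f i)
   else +oo)%E.

Definition is_minimizer (F : X -> \bar R) (S : set X) (u : X) : Prop :=
  S u /\ forall v, S v -> (F u <= F v)%E.

Definition minimal_solution (F : X -> \bar R) (I : {set 'I_N})
    (f : forall i, Y i) (u : X) : Prop :=
  is_minimizer F [set v | domT v /\ forall i, i \in I -> T i v = f i] u /\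
  (F u < +oo)%E.

Record assumptionN (tauX : topology_on X)
    (tauY : forall i, topology_on (Y i)) : Prop := AssumptionN {
  N_norm_lsc : forall i (y : nat -> Y i) (l : Y i),
    converges_in (tauY i) y l ->
    (`|l|%:E <= limn_einf (fun n => `|y n|%:E))%E;
  N_add_continuous : forall i,
    continuous (fun z : retop (tauY i) * retop (tauY i) =>
      ((z.1 : Y i) + (z.2 : Y i) : retop (tauY i)));
  N_scale_continuous : forall i,
    continuous (fun z : R^o * retop (tauY i) =>
      ((z.1 : R) *: (z.2 : Y i) : retop (tauY i)));
  N_reg_lsc : lower_semicontinuous (reg : retop tauX -> \bar R);
  N_T_continuous : forall i,
    {within (dom i : set (retop tauX)),
      continuous (T i : retop tauX -> retop (tauY i))};
  N_dom_closed : forall i (u : nat -> X) (l : X),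
    (forall n, dom i (u n)) -> converges_in tauX u l -> dom i l;
  N_compact : forall (lam : 'I_N -> R) (f : forall i, Y i) (u : nat -> X)
      (c : R),
    (forall i, 0 < lam i) ->
    (forall n, (Jfun predT (fun i => (lam i)%:E) f (u n) < c%:E)%E) ->
    exists (s : nat -> nat) (l : X),
      {homo s : m n / (m < n)%N} /\ converges_in tauX (u \o s) l
}.

End functionals.

Section convex_and_asymptotics.
Context (R : realType) (X : normedModType R).

Definition subgradient (F : X -> \bar R) (u : X) (xi : {linear X -> R^o}) :
    Prop :=
  continuous xi /\ (F u < +oo)%E /\
  forall v, (F u + (xi (v - u))%:E <= F v)%E.

Definition bregman (F : X -> \bar R) (xi : X -> R) (v u : X) : \bar R :=
  (F v - F u - (xi (v - u))%:E)%E.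

Definition asymp_equiv (x y : nat -> R) : Prop :=
  exists c C : R, 0 < c /\ 0 < C /\ forall n, c * y n <= x n <= C * y n.

Definition bigO_seq (x : nat -> \bar R) (y : nat -> R) : Prop :=
  exists2 C : R, 0 < C & \forall n \near \oo, (x n <= (C * y n)%:E)%E.

Definition rate (N : nat) (I : {set 'I_N}) (p eps : 'I_N -> R)
    (phi : 'I_N -> R -> R) (d : 'I_N -> R) : R :=
  \sum_(i in I | p i == 1) d i `^ eps i + \sum_(i in I | 1 < p i) d i +
  \sum_(i | i \notin I) (d i + phi i (d i)).

End convex_and_asymptotics.

(* Main.v *)
Require Import Defs.
From HB Require Import structures.
From mathcomp Require Import all_boot all_order all_algebra.
From mathcomp Require Import all_classical all_reals all_analysis.
From mathcomp Require Import lra.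

Set Implicit Arguments.
Unset Strict Implicit.
Unset Printing Implicit Defensive.

Import Order.TTheory GRing.Theory Num.Theory.
Import numFieldNormedType.Exports.

Local Open Scope classical_set_scope.
Local Open Scope ring_scope.

(** The minimizers are compared with the exact solution through a single chain
    of inequalities.  Write [a i n] for the residual [`|T i (u n) - f n i|].
    Minimality of [u n] bounds its noisy energy by that of [ud].  In the energy
    of [ud] a term with [i] in [I] has residual [delta], because [T i ud = fd i],
    so it costs at most a multiple of [delta `^ (- s) * delta `^ p]; the exponent
    [s] of the weight is [1 - eps] or [p - 1], which leaves [delta `^ eps] or
    [delta].  Outside [I] the weights and the data converge, and replacing them
    by their limits costs [O(delta + phi(delta))], since a power is Lipschitz on
    bounded sets; the residuals of [u n] are bounded because the weights outside
    [I] stay away from [0].  Hence, with [r] the error rate,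
      [F (u n) + \sum_(i in I) lam n i * a i n `^ p i <= F ud + O(r n)],
    which is [energy_estimate].  Dropping the sum gives the first claim.

    The same inequality shows that the residuals in [I] tend to [0], because
    their weights blow up.  So [u n] eventually lies in the sublevel set on which
    the source condition is assumed.  Inserting that condition,
      [(1 - beta1) * D n + \sum_(i in I) lam n i * a i n `^ p i
         <= beta2 * \sum_(i in I) `|T i (u n) - T i ud| + O(r n)],
    where [D n] is the Bregman distance.  The linear residuals on the right are
    absorbed by half of the weighted powers on the left
    ([residual_absorbed]): for [p i = 1] because the weight is eventually large,
    for [1 < p i] by Young's inequality ([linear_absorbed_by_powR]).  What remains
    bounds [D n] and each [lam n i * a i n `^ p i] by [O(r n)]
    ([source_estimate]); dividing by the weight yields the residual rates. *)

(** * Powers of nonnegative reals *)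

Section powers.
Context {R : realType}.
Implicit Types p M a b c d l t : R.

(** The derivative [p * t `^ (p - 1)] is bounded for [0 < t <= M], so the mean
    value theorem applies between positive points.  The power jumps to [1] on the
    negative reals, so the chord from [0] is treated separately. *)
Lemma powR_lipschitz p M : 1 <= p -> 0 <= M ->
  exists2 L, 0 < L & forall a b, 0 <= a <= M -> 0 <= b <= M ->
    a `^ p - b `^ p <= L * `|a - b|.
Proof.
move=> p1 M0; have p0 : 0 < p by lra.
have MP : 0 <= M `^ (p - 1) by exact: powR_ge0.
have le_MP (t : R) : 0 <= t <= M -> t `^ (p - 1) <= M `^ (p - 1).
  by move=> /andP[t0 tM]; apply: ge0_ler_powR; rewrite ?nnegrE //; lra.
exists (p * M `^ (p - 1) + 1) => [|a b /andP[a0 aM] /andP[b0 bM]].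
  by rewrite ltr_wpDl // mulr_ge0 // ltW.
have [ab|ba] := leP a b.
  apply: (@le_trans _ _ 0); last by rewrite mulr_ge0 // addr_ge0 // mulr_ge0 // ltW.
  by rewrite subr_le0; apply: ge0_ler_powR; rewrite ?nnegrE // ltW.
rewrite gtr0_norm ?subr_gt0 //.
have [->|b_neq0] := eqVneq b 0.
  rewrite powR0 ?gt_eqF // !subr0 -mulr_powRB1 //.
  have haM : a * a `^ (p - 1) <= a * M `^ (p - 1).
    by rewrite ler_wpM2l // le_MP ?a0.
  have : 0 <= (p - 1) * (a * M `^ (p - 1)) by rewrite !mulr_ge0 ?subr_ge0.
  nra.
have bgt0 : 0 < b by rewrite lt_def b_neq0.
have [t /itvP tab ->] : exists2 t, t \in `]b, a[ &
    a `^ p - b `^ p = (p * t `^ (p - 1)) * (a - b).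
  apply: (@MVT _ (@powR R ^~ p) (fun t => p * t `^ (p - 1))) => //.
    move=> x; rewrite in_itv /= => /andP[bx _].
    exact/is_derive1_powR/(lt_trans bgt0 bx).
  apply: derivable_within_continuous => x; rewrite in_itv /= => /andP[bx _].
  apply: derivable_powR; rewrite in_itv /= andbT.
  exact: lt_le_trans bgt0 bx.
have bt : b < t by rewrite tab.
have ta : t < a by rewrite tab.
have htM : p * t `^ (p - 1) <= p * M `^ (p - 1).
  by rewrite ler_wpM2l ?(ltW p0) // le_MP; lra.
by rewrite ler_wpM2r; lra.
Qed.

(** From [l * a `^ p - l' * b `^ p = l * (a `^ p - b `^ p) + (l - l') * b `^ p],
    where [l] and [b `^ p] are bounded. *)
Lemma weighted_powR_perturb p M : 1 <= p -> 0 <= M ->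
  exists2 K, 0 < K & forall l l' a b d e,
    0 <= l <= M -> 0 <= a <= M -> 0 <= b <= M ->
    `|a - b| <= d -> `|l - l'| <= e ->
    l * a `^ p <= l' * b `^ p + K * (d + e).
Proof.
move=> p1 M0; have [L L0 lipL] := powR_lipschitz p1 M0.
have MP : 0 <= M `^ p by exact: powR_ge0.
exists (M * L + M `^ p + 1) => [|l l' a b d e /andP[l0 lM] aM bM abd lle].
  by nra.
have h1 := lipL _ _ aM bM.
have bp0 : 0 <= b `^ p by exact: powR_ge0.
have bpM : b `^ p <= M `^ p.
  by case/andP: bM => b0 bM; apply: ge0_ler_powR; rewrite ?nnegrE //; lra.
have d0 : 0 <= d by exact: le_trans abd.
have e0 : 0 <= e by exact: le_trans lle.
have h2 : l * (a `^ p - b `^ p) <= M * (L * d).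
  apply: (@le_trans _ _ (l * (L * d))); last by apply: ler_wpM2r => //; nra.
  by apply: ler_wpM2l => //; apply: le_trans h1 _; rewrite ler_wpM2l // ltW.
have h3 : (l - l') * b `^ p <= e * M `^ p.
  apply: (@le_trans _ _ (`|l - l'| * b `^ p)).
    by rewrite ler_wpM2r // ler_norm.
  exact: ler_pM.
have h4 : 0 <= M * L * e by rewrite !mulr_ge0 // ltW.
have h5 : 0 <= M `^ p * d by exact: mulr_ge0.
by nra.
Qed.

(** Young's inequality in the form that the critical weight [d `^ (- (p - 1))]
    allows.  Up to the threshold [a = Q * d] the left-hand side is of order [d];
    beyond it [a `^ (p - 1)] is so large that the weighted power dominates. *)
Lemma linear_absorbed_by_powR p c beta : 1 < p -> 0 < c -> 0 < beta ->
  exists2 K, 0 < K & forall l a d,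
    0 <= a -> 0 < d -> c * d `^ (- (p - 1)) <= l ->
    beta * a <= l * a `^ p / 2 + K * d.
Proof.
move=> p1 c0 b0; pose Q := (2 * beta / c) `^ (p - 1)^-1.
have bc0 : 0 < 2 * beta / c by rewrite divr_gt0 // mulr_gt0.
have Q0 : 0 < Q by exact: powR_gt0.
have QE : c * Q `^ (p - 1) = 2 * beta.
  rewrite /Q -powRrM mulVf ?powRr1 ?(ltW bc0) //; last by rewrite gt_eqF//; lra.
  by rewrite mulrC divfK // gt_eqF.
exists (beta * Q) => [|l a d a0 d0 ld]; first exact: mulr_gt0.
have l0 : 0 <= l.
  by apply: le_trans ld; rewrite mulr_ge0 ?powR_ge0 // ltW.
have [aQ|Qa] := leP a (Q * d).
  have : beta * a <= beta * (Q * d) by rewrite ler_wpM2l // ltW.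
  have : 0 <= l * a `^ p by rewrite mulr_ge0 ?powR_ge0.
  by rewrite mulrA; lra.
have Qd0 : 0 < Q * d by exact: mulr_gt0.
suff : 2 * beta * a <= l * a `^ p.
  by have := mulr_gt0 b0 Qd0; rewrite mulrA; lra.
rewrite -mulr_powRB1 //; last by lra.
rewrite mulrCA [leLHS]mulrC ler_wpM2l //.
apply: (@le_trans _ _ (c * d `^ (- (p - 1)) * (Q * d) `^ (p - 1))).
  rewrite powRM ?(ltW Q0) ?(ltW d0) // powRN -QE.
  rewrite [X in _ <= X](_ : _ = c * Q `^ (p - 1) *
    ((d `^ (p - 1))^-1 * d `^ (p - 1))); last first.
    by rewrite mulrACA -!mulrA; congr (_ * _); rewrite [RHS]mulrCA.
  by rewrite mulVf ?mulr1 // gt_eqF // powR_gt0.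
apply: ler_pM => //; rewrite ?mulr_ge0 ?powR_ge0 ?(ltW c0) //.
by apply: ge0_ler_powR; rewrite ?nnegrE; lra.
Qed.

End powers.

(** * Inequalities up to an error of a given order *)

Section asymptotic_order.
Context {R : realType}.
Implicit Types x y z g : nat -> R.

(** Every estimate on sequences below has this form, so that constants are
    named only where they are created. *)
Definition le_upto x y g : Prop :=
  exists2 C : R, 0 < C & \forall n \near \oo, x n <= y n + C * g n.

Lemma le_upto_near x y g :
  (\forall n \near \oo, 0 <= g n) -> (\forall n \near \oo, x n <= y n) ->
  le_upto x y g.
Proof.
by move=> g0 xy; exists 1 => //; near=> n; rewrite mul1r ler_wpDr //; near: n.
Unshelve. all: by end_near. Qed.

Lemma le_upto_trans y x z g : le_upto x y g -> le_upto y z g -> le_upto x z g.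
Proof.
move=> [C C0 xy] [D D0 yz]; exists (C + D); first exact: addr_gt0.
near=> n; rewrite mulrDl addrA addrAC.
apply: (@le_trans _ _ (y n + C * g n)); first by near: n.
by rewrite lerD2r; near: n.
Unshelve. all: by end_near. Qed.

Lemma le_uptoD x y x' y' g :
  le_upto x y g -> le_upto x' y' g ->
  le_upto (fun n => x n + x' n) (fun n => y n + y' n) g.
Proof.
move=> [C C0 xy] [D D0 xy']; exists (C + D); first exact: addr_gt0.
near=> n; rewrite mulrDl addrACA; apply: lerD; by near: n.
Unshelve. all: by end_near. Qed.

Lemma le_upto_sum (J : finType) (P : pred J) (x y : J -> nat -> R) g :
  (\forall n \near \oo, 0 <= g n) ->
  (forall i, P i -> le_upto (x i) (y i) g) ->
  le_upto (fun n => \sum_(i | P i) x i n) (fun n => \sum_(i | P i) y i n) g.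
Proof.
move=> g0 xy; elim: (index_enum J) => [|i r IH].
  by apply: le_upto_near => //; near=> n; rewrite !big_nil.
have [Pi|Pi] := boolP (P i); last first.
  by under eq_fun do rewrite big_cons (negbTE Pi);
     under [in X in le_upto _ X _]eq_fun do rewrite big_cons (negbTE Pi).
under eq_fun do rewrite big_cons Pi.
under [in X in le_upto _ X _]eq_fun do rewrite big_cons Pi.
exact: le_uptoD (xy _ Pi) IH.
Unshelve. all: by end_near. Qed.

(** One-sided continuity suffices for nonnegative arguments. *)
Lemma cvg0_comp_right (h : R -> R) x : h 0 = 0 ->
  h t @[t --> 0^'+] --> (0 : R) ->
  (forall n, 0 <= x n) -> x @ \oo --> (0 : R) -> h (x n) @[n --> \oo] --> (0 : R).
Proof.
move=> h0 hr x0 xc; apply/cvgr0Pnorm_lt => e e0.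
have /cvgr0Pnorm_lt/(_ e e0) := hr; rewrite near_withinE => /nbhs_ballP[d d0 hd].
have /cvgr0Pnorm_lt/(_ d d0) := xc; apply: filterS => n xd.
have [->|xn0] := eqVneq (x n) 0; first by rewrite h0 normr0.
apply: hd; last by rewrite lt_def xn0 x0.
by rewrite /ball /= sub0r normrN.
Qed.

Lemma cvg0_sum (J : finType) (P : pred J) (x : J -> nat -> R) :
  (forall i, P i -> x i @ \oo --> (0 : R)) ->
  (fun n => \sum_(i | P i) x i n) @ \oo --> (0 : R).
Proof.
move=> x0; elim: (index_enum J) => [|i r IH].
  by under eq_fun do rewrite big_nil; exact: cvg_cst.
have [Pi|Pi] := boolP (P i); last by under eq_fun do rewrite big_cons (negbTE Pi).
under eq_fun do rewrite big_cons Pi.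
have := cvgD (x0 i Pi) IH; rewrite addr0.
exact.
Qed.

End asymptotic_order.

(** * Energy estimate for the critical weights *)

Section weights.
Context {R : realType} (J : finType) (I : {set J}) (p s : J -> R).
Context (delta e lam : J -> nat -> R) (L : J -> R).
Hypothesis p_ge1 : forall i, 1 <= p i.
Hypothesis s_gt0 : forall i, i \in I -> 0 < s i.
Hypothesis s_range : forall i, i \in I -> p i - 1 <= s i < p i.
Hypothesis delta_ge0 : forall i n, 0 <= delta i n.
Hypothesis delta_cvg0 : forall i, delta i @ \oo --> (0 : R).
Hypothesis lam_gt0 : forall i n, 0 < lam i n.
Hypothesis lam_critical : forall i, i \in I ->
  asymp_equiv (lam i) (fun n => delta i n `^ (- s i)).
Hypothesis e_ge0 : forall i, i \notin I -> forall n, 0 <= e i n.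
Hypothesis e_cvg0 : forall i, i \notin I -> e i @ \oo --> (0 : R).
Hypothesis L_gt0 : forall i, i \notin I -> 0 < L i.
Hypothesis lam_cvg : forall i, i \notin I -> forall n, `|L i - lam i n| <= e i n.

(** The size of the error that the noise causes in the [i]-th fidelity term: for
    a weight of order [delta `^ (- s)] the noise itself costs
    [delta `^ (p - s)]. *)
Definition term_error i n : R :=
  if i \in I then delta i n `^ (p i - s i) else delta i n + e i n.

Definition total_error n : R := \sum_i term_error i n.

Lemma term_error_ge0 i n : 0 <= term_error i n.
Proof.
rewrite /term_error; case: ifPn => [_|iI]; first exact: powR_ge0.
by rewrite addr_ge0 // e_ge0.
Qed.

Lemma total_error_ge0 n : 0 <= total_error n.
Proof. by apply: sumr_ge0 => i _; exact: term_error_ge0. Qed.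

Lemma term_error_le i n : term_error i n <= total_error n.
Proof.
rewrite /total_error (bigD1 i) //= lerDl.
by apply: sumr_ge0 => j _; exact: term_error_ge0.
Qed.

Lemma delta_powR_cvg0 i r : 0 < r -> delta i n `^ r @[n --> \oo] --> (0 : R).
Proof.
move=> r0; apply: (cvg0_comp_right (h := @powR R ^~ r)) => //.
- by rewrite powR0 // gt_eqF.
- exact: powR_cvg0.
Qed.

Lemma total_error_cvg0 : total_error @ \oo --> (0 : R).
Proof.
apply: cvg0_sum => i _; have [iI|iI] := boolP (i \in I).
  rewrite (_ : term_error i = fun n => delta i n `^ (p i - s i)); last first.
    by apply/funext => n; rewrite /term_error iI.
  by apply: delta_powR_cvg0; have := s_range iI; lra.
rewrite (_ : term_error i = delta i \+ e i); last first.
  by apply/funext => n; rewrite /term_error (negbTE iI).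
by have := cvgD (delta_cvg0 i) (e_cvg0 iI); rewrite addr0; exact.
Qed.

Lemma near_total_error_ge0 : \forall n \near \oo, 0 <= total_error n.
Proof. by near=> n; exact: total_error_ge0. Unshelve. all: by end_near. Qed.

(** A vanishing [delta i n] would force the positive weight [lam i n] below a
    multiple of [0 `^ (- s i) = 0]. *)
Lemma delta_gt0 i n : i \in I -> 0 < delta i n.
Proof.
move=> iI; rewrite lt_def delta_ge0 andbT; apply/eqP => d0.
have [c [C [_ [_ /(_ n)/andP[_]]]]] := lam_critical iI.
rewrite d0 powR0; first by rewrite mulr0 leNgt lam_gt0.
by rewrite oppr_eq0 gt_eqF // s_gt0.
Qed.

Lemma critical_weight_large i K : i \in I -> \forall n \near \oo, K <= lam i n.
Proof.
move=> iI; have [c [C [c0 [_ lamB]]]] := lam_critical iI.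
have K0 : 0 < `|K| + 1 by rewrite ltr_wpDl.
have /cvgr0Pnorm_lt/(_ _ (divr_gt0 c0 K0)) := delta_powR_cvg0 i (s_gt0 iI).
apply: filterS => n; rewrite ger0_norm ?powR_ge0 // ltr_pdivlMr // => h.
have ds0 : 0 < delta i n `^ s i by rewrite powR_gt0 // delta_gt0.
have /andP[+ _] := lamB n; apply: le_trans.
rewrite powRN ler_pdivlMr //; apply: (@le_trans _ _ ((`|K| + 1) * delta i n `^ s i)).
  by rewrite ler_wpM2r ?(ltW ds0) //; have := ler_norm K; lra.
by rewrite mulrC ltW.
Qed.

Lemma critical_noise_term i (x : nat -> R) : i \in I ->
  (forall n, 0 <= x n <= delta i n) ->
  le_upto (fun n => lam i n * x n `^ p i) (fun=> 0) total_error.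
Proof.
move=> iI xd; have [c [C [_ [C0 lamB]]]] := lam_critical iI.
exists C => //; near=> n; rewrite add0r.
have p0 : 0 <= p i by have := p_ge1 i; lra.
have /andP[x0 xn] := xd n; have /andP[_ lamC] := lamB n.
apply: (@le_trans _ _ (C * term_error i n)); last first.
  by rewrite ler_wpM2l ?(ltW C0) // term_error_le.
rewrite /term_error iI addrC powRD; last first.
  by apply/implyP => _; rewrite gt_eqF // delta_gt0.
rewrite mulrA; apply: ler_pM => //; rewrite ?powR_ge0 ?(ltW (lam_gt0 _ _)) //.
by apply: ge0_ler_powR; rewrite ?nnegrE.
Unshelve. all: by end_near. Qed.

(** With [(w, w') = (lam, L)] this removes the noise from the energy of the exact
    solution, with [(w, w') = (L, lam)] from that of the minimizers. *)
Lemma limit_weight_term i (w w' x y : nat -> R) B : i \notin I -> 0 <= B ->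
  (\forall n \near \oo, 0 <= w n <= B) ->
  (\forall n \near \oo, 0 <= x n <= B) -> (\forall n \near \oo, 0 <= y n <= B) ->
  (forall n, `|x n - y n| <= delta i n) -> (forall n, `|w n - w' n| <= e i n) ->
  le_upto (fun n => w n * x n `^ p i) (fun n => w' n * y n `^ p i) total_error.
Proof.
move=> iI B0 wB xB yB xy ww'.
have [K K0 HK] := weighted_powR_perturb (p_ge1 i) B0.
exists K => //; near=> n.
apply: (@le_trans _ _ (w' n * y n `^ p i + K * (delta i n + e i n))).
  by apply: HK => //; near: n.
rewrite lerD2l ler_wpM2l ?(ltW K0) //.
by have := term_error_le i n; rewrite /term_error (negbTE iI).
Unshelve. all: by end_near. Qed.

Lemma limit_weight_bounds i : i \notin I ->
  \forall n \near \oo, L i / 2 <= lam i n <= L i + 1.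
Proof.
move=> iI; have L0 := L_gt0 iI.
have L2 : 0 < Num.min (L i / 2) 1 by rewrite lt_min; apply/andP; split; lra.
have /cvgr0Pnorm_lt/(_ _ L2) := e_cvg0 iI; apply: filterS => n.
rewrite ger0_norm ?e_ge0 // lt_min => /andP[e1 e2].
by have := lam_cvg iI n; rewrite ler_norml; lra.
Qed.

(** The lower bound [L / 2] on the weight bounds the power, and
    [x <= 1 + x `^ p] bounds the argument. *)
Lemma limit_weight_argument_bounded i (x : nat -> R) M : i \notin I ->
  (\forall n \near \oo, lam i n * x n `^ p i <= M) ->
  \forall n \near \oo, x n <= 1 + 2 * `|M| / L i.
Proof.
move=> iI; apply: filterS2 (limit_weight_bounds iI) => n /andP[lamL _] xM.
have L0 := L_gt0 iI.
have M0 : 0 <= 2 * `|M| / L i by rewrite divr_ge0 ?(ltW L0) // mulr_ge0.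
have [x1|x1] := leP (x n) 1; first lra.
have xp : x n <= x n `^ p i by apply: le1r_powR; rewrite ?p_ge1 // ltW.
suff : x n `^ p i <= 2 * `|M| / L i by lra.
rewrite ler_pdivlMr //.
have : x n `^ p i * (L i / 2) <= x n `^ p i * lam i n.
  by rewrite ler_wpM2l ?powR_ge0.
by have := ler_norm M; lra.
Qed.

Section energy.
Context (rho : nat -> R) (rho' : R) (a b a' : J -> nat -> R) (b' : J -> R).
Hypothesis rho_ge0 : forall n, 0 <= rho n.
Hypothesis a_ge0 : forall i n, 0 <= a i n.
Hypothesis b_ge0 : forall i n, 0 <= b i n.
Hypothesis a'_ge0 : forall i n, 0 <= a' i n.
Hypothesis b'_ge0 : forall i, 0 <= b' i.
Hypothesis ab_delta : forall i n, `|a i n - b i n| <= delta i n.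
Hypothesis ab'_delta : forall i n, `|a' i n - b' i| <= delta i n.
Hypothesis b'_eq0 : forall i, i \in I -> b' i = 0.
Hypothesis energy_min : forall n,
  rho n + \sum_i lam i n * a i n `^ p i <=
  rho' + \sum_i lam i n * a' i n `^ p i.

Let comparison_energy :
  le_upto (fun n => rho' + \sum_i lam i n * a' i n `^ p i)
    (fun=> rho' + \sum_(i | i \notin I) L i * b' i `^ p i) total_error.
Proof.
have g0 := near_total_error_ge0.
apply: le_uptoD; first by apply: le_upto_near => //; near=> n.
under eq_fun do rewrite (bigID (mem I)) /=.
rewrite -[X in le_upto _ (fun=> X) _]add0r.
apply: le_uptoD.
  apply: (@le_upto_trans _ (fun n => \sum_(i in I) 0)); last first.
    by apply: le_upto_near => //; near=> n; rewrite big1.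
  apply: le_upto_sum => // i iI; apply: critical_noise_term => // n.
  have := ab'_delta i n; rewrite b'_eq0 // subr0 a'_ge0.
  exact: le_trans (ler_norm _).
apply: le_upto_sum => // i iI.
have B0 : 0 <= b' i + 1 + (L i + 1).
  by have := b'_ge0 i; have := L_gt0 iI; lra.
apply: (limit_weight_term iI B0).
- apply: filterS (limit_weight_bounds iI) => n.
  have := lam_gt0 i n; have := b'_ge0 i; lra.
- have /cvgr0Pnorm_lt/(_ _ ltr01) := delta_cvg0 i; apply: filterS => n.
  rewrite ger0_norm // => d1; have := ab'_delta i n; rewrite ler_norml.
  by have := a'_ge0 i n; have := L_gt0 iI; lra.
- by near=> n; have := b'_ge0 i; have := L_gt0 iI; lra.
- by move=> n; exact: ab'_delta.
- by move=> n; rewrite distrC; exact: lam_cvg.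
Unshelve. all: by end_near. Qed.

Let term_le_energy i n :
  lam i n * a i n `^ p i <= rho' + \sum_i lam i n * a' i n `^ p i.
Proof.
apply: le_trans (energy_min n); rewrite (bigD1 i) //= addrCA lerDl.
rewrite addr_ge0 //; apply: sumr_ge0 => j _.
by rewrite mulr_ge0 ?powR_ge0 // ltW.
Qed.

(** Replacing the noisy data and weights by their limits changes both sides of
    the minimality inequality only by the order of the error.  On the side of
    the minimizers this needs their residuals to be bounded, which follows from
    the inequality itself since the weights outside [I] stay away from [0]. *)
Lemma energy_estimate :
  le_upto (fun n => rho n + \sum_(i | i \notin I) L i * b i n `^ p i +
                    \sum_(i in I) lam i n * a i n `^ p i)
    (fun=> rho' + \sum_(i | i \notin I) L i * b' i `^ p i) total_error.
Proof.
have g0 := near_total_error_ge0.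
apply: le_upto_trans comparison_energy.
apply: (@le_upto_trans _ (fun n => rho n + \sum_i lam i n * a i n `^ p i));
  last by apply: le_upto_near => //; near=> n.
under eq_fun do rewrite -addrA [X in _ + X]addrC.
under [in X in le_upto _ X _]eq_fun do rewrite (bigID (mem I)) /=.
apply: le_uptoD; first by apply: le_upto_near => //; near=> n.
apply: le_uptoD; first by apply: le_upto_near => //; near=> n.
apply: le_upto_sum => // i iI.
have [C C0 hC] := comparison_energy.
have [M hM] : exists M, \forall n \near \oo, lam i n * a i n `^ p i <= M.
  exists (rho' + \sum_(i | i \notin I) L i * b' i `^ p i + C * 1).
  have /cvgr0Pnorm_lt/(_ _ ltr01) := total_error_cvg0.
  apply: filterS2 hC => n hC; rewrite ger0_norm ?total_error_ge0 // => h1.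
  apply: le_trans (term_le_energy i n) (le_trans hC _).
  by rewrite lerD2l ler_wpM2l // ltW.
have aB := limit_weight_argument_bounded iI hM.
have L0 := L_gt0 iI.
have M0 : 0 <= 2 * `|M| / L i by rewrite divr_ge0 ?(ltW L0) // mulr_ge0.
have B0 : 0 <= L i + (1 + 2 * `|M| / L i + 1) by lra.
apply: (limit_weight_term iI B0).
- by near=> n; lra.
- have /cvgr0Pnorm_lt/(_ _ ltr01) := delta_cvg0 i.
  apply: filterS2 aB => n aB; rewrite ger0_norm // => d1.
  have := ab_delta i n; rewrite ler_norml.
  by have := b_ge0 i n; lra.
- by apply: filterS aB => n aB; have := a_ge0 i n; lra.
- by move=> n; rewrite distrC; exact: ab_delta.
- by move=> n; exact: lam_cvg.
Unshelve. all: by end_near. Qed.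

End energy.

Lemma critical_residual_cvg0 i (x : nat -> R) M : i \in I ->
  (forall n, 0 <= x n) -> (\forall n \near \oo, lam i n * x n `^ p i <= M) ->
  x @ \oo --> (0 : R).
Proof.
move=> iI x0 xM; have p0 : 0 < p i by have := p_ge1 i; lra.
apply/cvgr0Pnorm_lt => eta eta0.
have etap0 : 0 < eta `^ p i by exact: powR_gt0.
apply: filterS2 xM (critical_weight_large ((`|M| + 1) / eta `^ p i) iI) => n xM.
rewrite (ger0_norm (x0 n)) ltNge ler_pdivrMr // => lamM; apply/negP => etax.
have : lam i n * eta `^ p i <= lam i n * x n `^ p i.
  rewrite ler_wpM2l ?(ltW (lam_gt0 _ _)) //.
  by apply: ge0_ler_powR; rewrite ?nnegrE ?(ltW p0) ?(ltW eta0).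
by have := ler_norm M; lra.
Qed.

(** * Consequences of the source condition *)

Section source.
Context (a b : J -> nat -> R).
Hypothesis a_ge0 : forall i n, 0 <= a i n.
Hypothesis b_le : forall i n, b i n <= a i n + delta i n.

Let delta_le_term_error i : i \in I ->
  \forall n \near \oo, delta i n <= term_error i n.
Proof.
move=> iI; have /cvgr0Pnorm_lt/(_ _ ltr01) := delta_cvg0 i.
apply: filterS => n; rewrite ger0_norm // /term_error iI => d1.
apply: ger1_powR; first by rewrite delta_gt0 // ltW.
by have := s_range iI; lra.
Qed.

(** For [p i = 1] the weight eventually exceeds any constant; for [1 < p i] it is
    at least of the order required by Young's inequality. *)
Lemma residual_absorbed i beta : i \in I -> 0 < beta ->
  le_upto (fun n => beta * b i n) (fun n => lam i n * a i n `^ p i / 2)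
    total_error.
Proof.
move=> iI beta0; have g0 := near_total_error_ge0.
have delta_small : le_upto (fun n => beta * delta i n) (fun=> 0) total_error.
  exists beta => //; apply: filterS (delta_le_term_error iI) => n dn.
  rewrite add0r ler_wpM2l ?(ltW beta0) //.
  exact: le_trans dn (term_error_le i n).
apply: (@le_upto_trans _ (fun n => beta * a i n + beta * delta i n)).
  by apply: le_upto_near => //; near=> n; rewrite -mulrDr ler_wpM2l // ltW.
rewrite (_ : (fun n => lam i n * a i n `^ p i / 2) =
    fun n => lam i n * a i n `^ p i / 2 + 0); last first.
  by apply/funext => n; rewrite addr0.
apply: le_uptoD => //.
have [p1|p1] := eqVneq (p i) 1.
  apply: le_upto_near => //.
  apply: filterS (critical_weight_large (2 * beta) iI) => n lamn.
  rewrite p1 powRr1 //.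
  have : 2 * beta * a i n <= lam i n * a i n by rewrite ler_wpM2r.
  by lra.
have {}p1 : 1 < p i by rewrite lt_def p1 p_ge1.
have [c [C [c0 [_ lamB]]]] := lam_critical iI.
have [K K0 HK] := linear_absorbed_by_powR p1 c0 beta0.
exists K => //.
have /cvgr0Pnorm_lt/(_ _ ltr01) := delta_cvg0 i.
apply: filterS2 (delta_le_term_error iI) => n dn; rewrite ger0_norm // => d1.
apply: le_trans (HK (lam i n) _ (delta i n) (a_ge0 i n) (delta_gt0 n iI) _) _.
  have /andP[+ _] := lamB n; apply: le_trans; rewrite ler_wpM2l ?(ltW c0) //.
  apply: ger_powR; first by rewrite delta_gt0 // ltW.
  by have := s_range iI; lra.
rewrite lerD2l ler_wpM2l ?(ltW K0) //.
exact: le_trans dn (term_error_le i n).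
Unshelve. all: by end_near. Qed.

(** Half of the weighted powers absorb the linear residuals of the source
    condition and the factor [1 - beta1] remains in front of [D], so all the
    nonnegative terms on the left-hand side are of the order of the error. *)
Lemma source_estimate (D : nat -> R) beta1 beta2 :
  beta1 < 1 -> 0 < beta2 -> (forall n, 0 <= D n) ->
  le_upto (fun n => D n + \sum_(i in I) lam i n * a i n `^ p i)
    (fun n => beta1 * D n + beta2 * \sum_(i in I) b i n) total_error ->
  le_upto D (fun=> 0) total_error /\
  forall j, j \in I ->
    le_upto (fun n => lam j n * a j n `^ p j) (fun=> 0) total_error.
Proof.
move=> b11 b20 D0 hD; have g0 := near_total_error_ge0.
pose S n := \sum_(i in I) lam i n * a i n `^ p i.
have S0 n : 0 <= S n.
  by apply: sumr_ge0 => i _; rewrite mulr_ge0 ?powR_ge0 // ltW.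
have [C C0 hC] : le_upto (fun n => D n + S n)
    (fun n => beta1 * D n + S n / 2) total_error.
  apply: le_upto_trans hD _; apply: le_uptoD.
    by apply: le_upto_near => //; near=> n.
  under eq_fun do rewrite mulr_sumr.
  under [in X in le_upto _ X _]eq_fun do rewrite mulr_suml.
  by apply: le_upto_sum => // i iI; exact: residual_absorbed.
split.
  exists (C / (1 - beta1)); first by rewrite divr_gt0 // subr_gt0.
  apply: filterS hC => n hC; rewrite add0r mulrAC ler_pdivlMr ?subr_gt0 //.
  by have := S0 n; lra.
move=> j jI; exists (2 * C); first by rewrite mulr_gt0.
apply: filterS hC => n hC; rewrite add0r.
have jS : lam j n * a j n `^ p j <= S n.
  rewrite /S (bigD1 j) //= lerDl.
  by apply: sumr_ge0 => i _; rewrite mulr_ge0 ?powR_ge0 // ltW.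
have : 0 <= (1 - beta1) * D n by rewrite mulr_ge0 // subr_ge0 ltW.
by lra.
Unshelve. all: by end_near. Qed.

Lemma residual_rate j : j \in I ->
  le_upto (fun n => lam j n * a j n `^ p j) (fun=> 0) total_error ->
  le_upto (fun n => a j n `^ p j) (fun=> 0)
    (fun n => delta j n `^ s j * total_error n).
Proof.
move=> jI [C C0 hC]; have [c [c' [c0 [_ lamB]]]] := lam_critical jI.
exists (C / c); first exact: divr_gt0.
apply: filterS hC => n; rewrite !add0r => hC.
have ds0 : 0 < delta j n `^ s j by rewrite powR_gt0 // delta_gt0.
have /andP[lamc _] := lamB n.
have : c * delta j n `^ (- s j) * a j n `^ p j <= C * total_error n.
  by apply: le_trans hC; rewrite ler_wpM2r ?powR_ge0.
rewrite powRN mulrAC ler_pdivrMr // => h.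
rewrite mulrAC ler_pdivlMr // mulrC; apply: le_trans h _.
by rewrite -mulrA [X in _ * X]mulrC.
Qed.

End source.

End weights.

(** * The functional at points of finite energy *)

Section functional.
Context {R : realType} {X : completeNormedModType R} {N : nat}
  {Y : 'I_N -> normedModType R} (reg : X -> \bar R) (p : 'I_N -> R)
  (dom : 'I_N -> set X) (T : forall i, X -> Y i).
Implicit Types (A : {pred 'I_N}) (lam : 'I_N -> \bar R).

Lemma fidelity_ge0 (V : normedModType R) (w : \bar R) q (y f : V) :
  (0 <= w)%E -> (0 <= fidelity w q y f)%E.
Proof.
move=> l0; rewrite /fidelity; case: ifP => _; first by case: ifP.
by rewrite mule_ge0 // lee_fin powR_ge0.
Qed.

Lemma fidelity_same (V : normedModType R) (w : \bar R) q (y : V) : q != 0 ->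
  fidelity w q y y = 0%E.
Proof.
by move=> q0; rewrite /fidelity eqxx subrr normr0 powR0 // mule0; case: ifP.
Qed.

Lemma Jfun_fin A lam (l : 'I_N -> R) f v :
  domT dom v -> reg v \is a fin_num -> {in A, forall i, lam i = (l i)%:E} ->
  Jfun reg p dom T A lam f v =
    (fine (reg v) + \sum_(i in A) l i * `|T i v - f i| `^ p i)%:E.
Proof.
move=> dv rv lamE; rewrite /Jfun mem_set // EFinD fineK //; congr (_ + _)%E.
rewrite -sumEFin; by apply: eq_bigr => i iA; rewrite lamE.
Qed.

(** A finite sum of nonnegative extended reals has finite terms. *)
Lemma Jfun_finite_reg A lam f v : domT dom v ->
  {in A, forall i, 0 <= lam i}%E -> (forall w, 0 <= reg w)%E ->
  (Jfun reg p dom T A lam f v < +oo)%E -> reg v \is a fin_num.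
Proof.
move=> dv lam0 reg0; rewrite /Jfun mem_set // ge0_fin_numE //.
apply: le_lt_trans; rewrite leeDl // sume_ge0 // => i iA.
exact/fidelity_ge0/lam0.
Qed.

End functional.

(** * The convergence rates *)

(** For [p i = 1] the weights have order [delta `^ (- (1 - eps i))], for
    [1 < p i] order [delta `^ (- (p i - 1))]; with this exponent the two cases are
    treated at once. *)
Definition weight_exponent (R : realType) (J : Type) (p eps : J -> R) i : R :=
  if p i == 1 then 1 - eps i else p i - 1.

Lemma rate_total_error (R : realType) (N : nat) (I : {set 'I_N})
    (p eps : 'I_N -> R) phi (delta : 'I_N -> nat -> R) n :
  (forall i, 1 <= p i) -> (forall i, 0 <= delta i n) ->
  rate I p eps phi (fun i => delta i n) =
  total_error I p (weight_exponent p eps) delta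
    (fun i m => phi i (delta i m)) n.
Proof.
move=> p1 d0; rewrite /rate /total_error [RHS](bigID (mem I)) /=; congr (_ + _).
  rewrite [RHS](bigID (fun i => p i == 1)) /=; congr (_ + _).
    apply: eq_bigr => i /andP[iI /eqP p_eq1].
    by rewrite /term_error iI /weight_exponent p_eq1 eqxx; congr (_ `^ _); lra.
  apply: eq_big => [i|i /andP[iI pi]]; first by rewrite lt_def p1 andbT.
  rewrite /term_error iI /weight_exponent gt_eqF //.
  by rewrite (_ : p i - (p i - 1) = 1) ?powRr1 //; lra.
by apply: eq_bigr => i iI; rewrite /term_error (negbTE iI).
Qed.

Theorem theorem3p5 (R : realType) (X : completeNormedModType R) (N : nat)
  (Y : 'I_N -> normedModType R) (reg : X -> \bar R) (p : 'I_N -> R)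
  (dom : 'I_N -> set X) (T : forall i, X -> Y i)
  (tauX : topology_on X) (tauY : forall i, topology_on (Y i))
  (hreg : forall u, (0 <= reg u)%E) (hp : forall i, 1 <= p i)
  (hproper : exists2 u, domT dom u & (reg u < +oo)%E)
  (htauX : hausdorff_space (retop tauX))
  (htauY : forall i, hausdorff_space (retop (tauY i)))
  (hN : assumptionN reg p dom T tauX tauY)
  (f : nat -> forall i, Y i) (fd : forall i, Y i)
  (delta : 'I_N -> nat -> R)
  (hdelta : forall i n, delta i n = `|fd i - f n i|)
  (hdelta0 : forall i, delta i @ \oo --> (0 : R))
  (I : {set 'I_N})
  (lam : nat -> 'I_N -> R) (hlam : forall n i, 0 < lam n i)
  (eps : 'I_N -> R)
  (heps : forall i, i \in I -> p i = 1 -> 0 < eps i < 1)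
  (hlam1 : forall i, i \in I -> p i = 1 ->
    asymp_equiv (fun n => lam n i) (fun n => delta i n `^ (- (p i - eps i))))
  (hlamp : forall i, i \in I -> 1 < p i ->
    asymp_equiv (fun n => lam n i) (fun n => delta i n `^ (- (p i - 1))))
  (lamd : 'I_N -> \bar R)
  (hlamd : forall i, (fun n => (lam n i)%:E) @ \oo --> lamd i)
  (hlamdIc : forall i, i \notin I -> (0 < lamd i < +oo)%E)
  (phi : 'I_N -> R -> R)
  (hphi_ge0 : forall i, i \notin I -> forall t, 0 <= t -> 0 <= phi i t)
  (hphi_cont : forall i, i \notin I -> {within `[0, +oo[, continuous (phi i)})
  (hphi_mono : forall i, i \notin I ->
    forall s t, 0 <= s -> s <= t -> phi i s <= phi i t)
  (hphi0 : forall i, i \notin I -> phi i 0 = 0)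
  (hphi : forall i, i \notin I ->
    forall n, (`|lamd i - (lam n i)%:E| <= (phi i (delta i n))%:E)%E)
  (u : nat -> X)
  (hu : forall n, is_minimizer
    (Jfun reg p dom T predT (fun i => (lam n i)%:E) (f n)) (domT dom) (u n))
  (ud : X)
  (hud : minimal_solution dom T
    (Jfun reg p dom T [predC I] lamd fd) I fd ud) :
  let F := Jfun reg p dom T [predC I] lamd fd in
  let r := fun n => rate I p eps phi (fun i => delta i n) in
  (exists2 C : R, 0 < C &
    \forall n \near \oo, (F (u n) <= F ud + (C * r n)%:E)%E) /\
  (forall (xi : {linear X -> R^o}) (beta1 beta2 e : R),
    subgradient F ud xi ->
    0 < beta1 < 1 -> 0 < beta2 -> 0 < e ->
    (forall v : X,
      (F v + (\sum_(i in I) `|T i v - fd i| `^ p i)%:E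
         <= Jfun reg p dom T predT lamd fd ud + e%:E)%E ->
      ((- xi (v - ud))%:E <= beta1%:E * bregman F xi v ud
         + (beta2 * \sum_(i in I) `|T i v - T i ud|)%:E)%E) ->
    bigO_seq (fun n => bregman F xi (u n) ud) r /\
    (forall j, j \in I ->
      (p j = 1 ->
        bigO_seq (fun n => `|T j (u n) - f n j|%:E)
          (fun n => delta j n `^ (1 - eps j) * r n)) /\
      (1 < p j ->
        bigO_seq (fun n => (`|T j (u n) - f n j| `^ p j)%:E)
          (fun n => delta j n `^ (p j - 1) * r n)))).
Proof.
move=> F r.
have d_ge0 i n : 0 <= delta i n by rewrite hdelta.
pose s := weight_exponent p eps.
pose a i n := `|T i (u n) - f n i|.
pose b i n := `|T i (u n) - fd i|.
pose L i := fine (lamd i).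
have LE i : i \notin I -> lamd i = (L i)%:E.
  move=> /hlamdIc/andP[l0 l1]; rewrite fineK // ge0_fin_numE //; exact: ltW.
have p_neq0 i : p i != 0 by rewrite gt_eqF // (lt_le_trans ltr01).
have s_gt0 i : i \in I -> 0 < s i.
  rewrite /s /weight_exponent => iI; have [p1|p1] := eqVneq (p i) 1.
    by have := heps i iI p1; lra.
  by rewrite subr_gt0 lt_def p1 hp.
have s_range i : i \in I -> p i - 1 <= s i < p i.
  rewrite /s /weight_exponent => iI; have [p1|p1] := eqVneq (p i) 1.
    by have := heps i iI p1; lra.
  lra.
pose w i n := lam n i.
have w_gt0 i n : 0 < w i n by exact: hlam.
have w_crit i : i \in I -> asymp_equiv (w i) (fun n => delta i n `^ (- s i)).
  rewrite /s /weight_exponent => iI; have [p1|p1] := eqVneq (p i) 1.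
    by rewrite -p1; exact: hlam1.
  by apply: hlamp => //; rewrite lt_def p1 hp.
have e_ge0 i : i \notin I -> forall n, 0 <= phi i (delta i n).
  by move=> iI n; exact: hphi_ge0.
have e_cvg0 i : i \notin I -> phi i (delta i n) @[n --> \oo] --> (0 : R).
  move=> iI; apply: cvg0_comp_right => //; first exact: hphi0.
  have /continuous_within_itvcyP[_] := hphi_cont i iI.
  by rewrite hphi0.
have L_gt0 i : i \notin I -> 0 < L i.
  by move=> iI; have := hlamdIc i iI; rewrite LE // lte_fin => /andP[].
have w_cvg i : i \notin I -> forall n, `|L i - w i n| <= phi i (delta i n).
  by move=> iI n; have := hphi i iI n; rewrite LE // -EFinB /= lee_fin.
have rE : r = total_error I p s delta (fun i m => phi i (delta i m)).
  by apply/funext => n; exact: rate_total_error.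
have r_cvg0 : r @ \oo --> (0 : R) by rewrite rE; exact: total_error_cvg0.
have [[[dud fud] hmin] Fud] := hud.
have reg_ud : reg ud \is a fin_num.
  apply: (Jfun_finite_reg dud _ hreg Fud) => i; rewrite inE => iI.
  by rewrite LE // lee_fin ltW // L_gt0.
have dom_u n : domT dom (u n) by have [] := hu n.
have JE n v : domT dom v -> reg v \is a fin_num ->
    Jfun reg p dom T predT (fun i => (lam n i)%:E) (f n) v =
    (fine (reg v) + \sum_i lam n i * `|T i v - f n i| `^ p i)%:E.
  by move=> dv rv; rewrite (Jfun_fin p T (l := lam n)).
have reg_u n : reg (u n) \is a fin_num.
  apply: (Jfun_finite_reg (A := predT) (lam := fun i => (lam n i)%:E)
    (dom_u n) _ hreg).
    by move=> i _; rewrite lee_fin ltW.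
  have [_ /(_ ud dud) hle] := hu n; apply: le_lt_trans hle _.
  by rewrite JE // ltry.
pose E v := fine (reg v) + \sum_(i | i \notin I) L i * `|T i v - fd i| `^ p i.
have FE v : domT dom v -> reg v \is a fin_num -> F v = (E v)%:E.
  by move=> dv rv; rewrite /F (Jfun_fin p T (l := L)).
have residual_dist i n (y : Y i) : `| `|y - f n i| - `|y - fd i| | <= delta i n.
  rewrite hdelta; apply: le_trans (ler_dist_dist _ _) _.
  by rewrite opprB addrC addrA subrK.
have estimate :
    le_upto (fun n => E (u n) + \sum_(i in I) w i n * a i n `^ p i)
      (fun=> E ud) r.
  rewrite rE; apply: (energy_estimate hp s_gt0 s_range d_ge0 hdelta0 w_gt0
    w_crit e_ge0 e_cvg0 L_gt0 w_cvg (a' := fun i n => `|T i ud - f n i|)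
    (b' := fun i => `|T i ud - fd i|)) => //.
  - by move=> n; rewrite fine_ge0.
  - by move=> i n; rewrite /a.
  - by move=> i n; exact: residual_dist.
  - by move=> i iI; rewrite fud // subrr normr0.
  - by move=> n; have [_ /(_ ud dud)] := hu n; rewrite !JE // lee_fin.
have sum_ge0 n : 0 <= \sum_(i in I) w i n * a i n `^ p i.
  by apply: sumr_ge0 => i _; rewrite mulr_ge0 ?powR_ge0 // ltW.
split.
  have [C C0 hC] := estimate; exists C => //; apply: filterS hC => n hC.
  rewrite !FE // -EFinD lee_fin; apply: le_trans hC.
  by rewrite lerDl.
move=> xi beta1 beta2 eta [_ [_ xi_sub]] /andP[_ beta11] beta20 eta0 source.
pose D n := E (u n) - E ud - xi (u n - ud).
have bregE n : bregman F xi (u n) ud = (D n)%:E by rewrite /bregman !FE.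
have D_ge0 n : 0 <= D n.
  have := xi_sub (u n); rewrite !FE // -EFinD lee_fin /D.
  by rewrite -subr_ge0 opprD addrA.
have b_le i n : b i n <= a i n + delta i n.
  by rewrite hdelta [X in _ + X]distrC; exact: ler_distD.
(* Half of [eta] is kept for the residual powers in the sublevel condition. *)
have near_sol : \forall n \near \oo, E (u n) <= E ud + eta / 2 /\
    forall i, i \in I -> w i n * a i n `^ p i <= E ud + eta / 2.
  have [C C0] := estimate.
  have Ceta : 0 < eta / 2 / C by rewrite !divr_gt0.
  have /cvgr0Pnorm_lt/(_ _ Ceta) := r_cvg0.
  apply: filterS2 => n /(le_lt_trans (ler_norm _)).
  rewrite ltr_pdivlMr // => Cr hC; have sn := sum_ge0 n.
  have En : 0 <= E (u n).
    rewrite addr_ge0 ?fine_ge0 //; apply: sumr_ge0 => i iI.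
    by rewrite mulr_ge0 ?powR_ge0 // ltW // L_gt0.
  split=> [|i iI]; first lra.
  suff : w i n * a i n `^ p i <= \sum_(k in I) w k n * a k n `^ p k by lra.
  rewrite [leRHS](bigD1 i) //= lerDl.
  by apply: sumr_ge0 => j _; rewrite mulr_ge0 ?powR_ge0 // ltW.
(* The powers in the sublevel condition vanish as the weights in [I] blow up. *)
have b_cvg0 : (fun n => \sum_(i in I) b i n `^ p i) @ \oo --> (0 : R).
  apply: cvg0_sum => i iI; have p0 : 0 < p i by apply: lt_le_trans (hp i).
  apply: (cvg0_comp_right (h := @powR R ^~ (p i))) => //.
  - by rewrite powR0.
  - exact: powR_cvg0.
  - by move=> n; rewrite /b.
  have a_cvg0 : a i @ \oo --> (0 : R).
    apply: (critical_residual_cvg0 hp s_gt0 d_ge0 hdelta0 w_gt0 w_crit iI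
      (M := E ud + eta / 2)).
    - by move=> n; rewrite /a.
    - by apply: filterS near_sol => n [_ /(_ i iI)].
  apply: (squeeze_cvgr (f := fun=> 0) (h := a i \+ delta i)).
  - by apply: nearW => n; rewrite b_le andbT /b.
  - exact: cvg_cst.
  - by have := cvgD a_cvg0 (hdelta0 i); rewrite addr0; exact.
(* The terms in [I] vanish since [T i ud = fd i]. *)
have J_ud : Jfun reg p dom T predT lamd fd ud = (E ud)%:E.
  rewrite -FE // /F /Jfun mem_set //; congr (_ + _)%E.
  rewrite (bigID (mem I)) /= big1 ?add0e => [|i iI].
    by apply: eq_bigl => i; rewrite inE.
  by rewrite fud // fidelity_same.
have source_u : \forall n \near \oo,
    - xi (u n - ud) <= beta1 * D n + beta2 * \sum_(i in I) b i n.
  have eta2 : 0 < eta / 2 by rewrite divr_gt0.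
  have /cvgr0Pnorm_lt/(_ _ eta2) := b_cvg0.
  apply: filterS2 near_sol => n [En _] /(le_lt_trans (ler_norm _)) bn.
  have := source (u n); rewrite J_ud FE // bregE.
  rewrite -EFinM -!EFinD !lee_fin.
  rewrite (_ : \sum_(i in I) `|T i (u n) - T i ud| = \sum_(i in I) b i n);
    last by apply: eq_bigr => i iI; rewrite fud.
  by apply; rewrite /b in bn; lra.
have Dest : le_upto (fun n => D n + \sum_(i in I) w i n * a i n `^ p i)
    (fun n => beta1 * D n + beta2 * \sum_(i in I) b i n) r.
  have [C C0 hC] := estimate; exists C => //; apply: filterS2 hC source_u.
  by move=> n; rewrite /D; lra.
have [D_rate a_rate] : le_upto D (fun=> 0) r /\
    forall j, j \in I ->
      le_upto (fun n => w j n * a j n `^ p j) (fun=> 0) r.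
  rewrite rE in Dest *.
  apply: (source_estimate hp s_gt0 s_range d_ge0 hdelta0 w_gt0 w_crit e_ge0
    _ b_le beta11 beta20 D_ge0 Dest).
  by move=> i n; rewrite /a.
have bigO_of (x y g : nat -> R) : le_upto x (fun=> 0) g -> g =1 y ->
    bigO_seq (fun n => (x n)%:E) y.
  move=> [C C0 hC] gy; exists C => //; apply: filterS hC => n.
  by rewrite add0r gy lee_fin.
split; first by rewrite (eq_fun bregE); exact: bigO_of D_rate _.
move=> j jI.
have aj : le_upto (fun n => a j n `^ p j) (fun=> 0)
    (fun n => delta j n `^ s j * r n).
  have := a_rate j jI; rewrite rE.
  exact: (residual_rate s_gt0 d_ge0 w_gt0 w_crit).
split=> pj.
  rewrite (_ : (fun n => _) = fun n => (a j n `^ p j)%:E); last first.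
    by apply/funext => n; rewrite pj powRr1 // /a.
  by apply: bigO_of aj _ => n; rewrite /s /weight_exponent pj eqxx.
by apply: bigO_of aj _ => n; rewrite /s /weight_exponent gt_eqF.
Qed.
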